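(* Let $n\ge 1$ be an integer. For each integer $t$ with $0\le t\le \lfloor n/2\rfloor$, let $\mathcal{B}_t:=\mathcal{B}_{\mathbb{R}}\left(\bigoplus_{i=1}^{t}C(a_i,b_i)\oplus\bigoplus_{i=1}^{n-2t}[c_i]\right)\subseteq\mathbb{R}^{n\times n}$ denote the real bundle under similarity of a matrix of the displayed form, where $a_i,b_i,c_i\in\mathbb{R}$, $b_i>0$, and $(a_i,b_i)\neq(a_{i'},b_{i'})$ and $c_i\neq c_{i'}$ for $i\neq i'$ (the first direct sum is empty when $t=0$, the second is empty when $n=2t$; the set $\mathcal{B}_t$ does not depend on the choice of such parameters). Let $\overline{\mathcal{B}_t}$ denote the closure of $\mathcal{B}_t$ in $\mathbb{R}^{n\times n}$. Then $$\mathbb{R}^{n\times n}=\bigcup_{t=0}^{\lfloor n/2\rfloor}\overline{\mathcal{B}_t}.$$ Moreover: (i) $\operatorname{codim}_{\mathbb{R}}\mathcal{B}_t=0$ for all $0\le t\le\lfloor n/2\rfloor$; (ii) $\mathcal{B}_t\cap\overline{\mathcal{B}_{t'}}=\emptyset$ for all $0\le t,t'\le\lfloor n/2\rfloor$ with $t\neq t'$; (iii) $\mathcal{B}_t$ is an open subset of $\mathbb{R}^{n\times n}$ for all $0\le t\le\lfloor n/2\rfloor$.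
   Context: All topological notions are with respect to the standard Euclidean topology of $\mathbb{R}^{n\times n}$. Blocks: for $a,b\in\mathbb{R}$ with $b>0$, $C(a,b)=\begin{bmatrix}a&b\\-b&a\end{bmatrix}$ (with eigenvalues $a\pm b\,\mathrm{i}$). $C_k(a,b)$ is the $2k\times 2k$ block upper bidiagonal matrix with $k$ diagonal blocks equal to $C(a,b)$ and with identity blocks $I_2$ on the block superdiagonal. For $c\in\mathbb{R}$, $J_k(c)$ is the $k\times k$ Jordan block with diagonal entries $c$ and ones on the superdiagonal; $J_1(c)=[c]$. $\bigoplus$ and $\oplus$ denote the block-diagonal direct sum of matrices. Real Jordan canonical form (RJCF): every $A\in\mathbb{R}^{n\times n}$ is similar, through a real invertible matrix, to a direct sum, unique up to permutation of the blocks, $$\mathrm{RJCF}(A)=\bigoplus_{i=1}^r\Big(\bigoplus_{j=1}^{d_i}C_{\ell_{j,i}}(\tilde a_i,\tilde b_i)\Big)\oplus\bigoplus_{i=1}^s\Big(\bigoplus_{j=1}^{e_i}J_{k_{j,i}}(\tilde c_i)\Big),$$ with $\tilde a_i,\tilde b_i,\tilde c_i\in\mathbb{R}$, $\tilde b_i>0$, $(\tilde a_i,\tilde b_i)\ne(\tilde a_{i'},\tilde b_{i'})$ and $\tilde c_i\neq\tilde c_{i'}$ for $i\ne i'$. Here $r$ is the number of distinct pairs of non-real conjugate eigenvalues of $A$ and $s$ is the number of distinct real eigenvalues (either may be $0$). Orbit: $\mathcal{O}_{\mathbb{R}}(A)=\{P^{-1}AP: P\in\mathbb{R}^{n\times n}\text{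 invertible}\}$. Bundle: with $\mathrm{RJCF}(A)=\bigoplus_{i=1}^r\Big(\bigoplus_{j=1}^{d_i}C_{\ell_{j,i}}(\tilde a_i,\tilde b_i)\Big)\oplus\bigoplus_{i=1}^s\Big(\bigoplus_{j=1}^{e_i}J_{k_{j,i}}(\tilde c_i)\Big)$, where $\tilde a_i,\tilde b_i,\tilde c_i\in\mathbb{R}$, $\tilde b_i>0$, $(\tilde a_i,\tilde b_i)\ne(\tilde a_{i'},\tilde b_{i'})$ and $\tilde c_i\neq\tilde c_{i'}$ for $i\ne i'$, the real bundle under similarity of $A$ is $$\mathcal{B}_{\mathbb{R}}(A)=\bigcup\ \mathcal{O}_{\mathbb{R}}\Big(\bigoplus_{i=1}^r\Big(\bigoplus_{j=1}^{d_i}C_{\ell_{j,i}}(a_i,b_i)\Big)\oplus\bigoplus_{i=1}^s\Big(\bigoplus_{j=1}^{e_i}J_{k_{j,i}}(c_i)\Big)\Big),$$ where the union is over all $a_i,b_i,c_i\in\mathbb{R}$ with $b_i>0$, $(a_i,b_i)\neq(a_{i'},b_{i'})$ for $i\neq i'$, and $c_i\ne c_{i'}$ for $i\neq i'$ (the numbers $r,s,d_i,e_i,\ell_{j,i},k_{j,i}$ being fixed by $A$). Codimensions: $\operatorname{codim}_{\mathbb{R}}\mathcal{O}_{\mathbb{R}}(A)=n^2-\dim_{\mathbb{R}}\{XA-AX:X\in\mathbb{R}^{n\times n}\}=\dim_{\mathbb{R}}\{X\in\mathbb{R}^{n\times n}: XA-AX=0\}$, and, by definition, $\operatorname{codim}_{\mathbb{R}}\mathcal{B}_{\mathbb{R}}(A)=\operatorname{codim}_{\mathbb{R}}\mathcal{O}_{\mathbb{R}}(A)-(2r+s)$,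 where $2r+s$ is the number of distinct complex eigenvalues of $A$. *)

(* Defs.v *)
From HB Require Import structures.
From mathcomp Require Import all_boot all_order all_algebra.
From mathcomp Require Import finmap.
From mathcomp Require Import all_classical all_reals topology.
From mathcomp Require Import normedtype.
From mathcomp.real_closed Require Import complex.

Set Implicit Arguments.
Unset Strict Implicit.
Unset Printing Implicit Defensive.

Import Order.TTheory GRing.Theory Num.Theory.
Import numFieldNormedType.Exports.

Local Open Scope classical_set_scope.
Local Open Scope ring_scope.

(* The eigenvalues of [blockC a b] are a +/- b i. *)
Definition blockC (R : realType) (a b : R) : 'M[R]_2 :=
  @block_mx R 1 1 1 1 a%:M b%:M (- b)%:M a%:M.

(* The k x k array of 2 x 2 blocks C_k(a, b); its size 2k is spelled
   \sum_(i < k) 2, as required by [mxblock]. *)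
Definition blockCk (R : realType) (k : nat) (a b : R) :
    'M[R]_(\sum_(i < k) 2) :=
  \mxblock_(i < k, j < k)
    (if i == j then blockC a b else if i.+1 == j then 1%:M else 0).

Definition blockJ (R : realType) (k : nat) (c : R) : 'M[R]_k :=
  \matrix_(i < k, j < k)
    (if i == j then c else if i.+1 == j then 1 else 0).

(* The discrete data r, d_i, l_{j,i}, s, e_i, k_{j,i} of a real Jordan
   canonical form of size n.  Every eigenvalue carries at least one block
   and no block is empty. *)
Record rjcf_shape (n : nat) := RJCFShape {
  sh_r : nat;
  sh_d : 'I_sh_r -> nat;
  sh_l : forall i : 'I_sh_r, 'I_(sh_d i) -> nat;
  sh_s : nat;
  sh_e : 'I_sh_s -> nat;
  sh_k : forall i : 'I_sh_s, 'I_(sh_e i) -> nat;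
  sh_d_gt0 : forall i, (0 < sh_d i)%N;
  sh_l_gt0 : forall i (j : 'I_(sh_d i)), (0 < sh_l j)%N;
  sh_e_gt0 : forall i, (0 < sh_e i)%N;
  sh_k_gt0 : forall i (j : 'I_(sh_e i)), (0 < sh_k j)%N;
  sh_size :
    (\sum_(i < sh_r) \sum_(j < sh_d i) \sum_(m < sh_l j) 2 +
     \sum_(i < sh_s) \sum_(j < sh_e i) sh_k j)%N = n
}.

Definition rjcf_mx (R : realType) (n : nat) (sh : rjcf_shape n)
    (a b : 'I_(sh_r sh) -> R) (c : 'I_(sh_s sh) -> R) : 'M[R]_n :=
  castmx (sh_size sh, sh_size sh)
    (block_mx
       (\mxdiag_(i < sh_r sh) \mxdiag_(j < sh_d i) blockCk (sh_l j) (a i) (b i))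
       0 0
       (\mxdiag_(i < sh_s sh) \mxdiag_(j < sh_e i) blockJ (sh_k j) (c i))).

Definition admissible (R : realType) (r s : nat)
    (a b : 'I_r -> R) (c : 'I_s -> R) : Prop :=
  [/\ forall i, 0 < b i,
      forall i i', i != i' -> (a i, b i) != (a i', b i')
    & forall i i', i != i' -> c i != c i'].

Definition similarity_orbit (R : realType) (n : nat) (A : 'M[R]_n) : set 'M[R]_n :=
  [set invmx P *m A *m P | P in [set P : 'M[R]_n | P \in unitmx]].

Definition has_rjcf (R : realType) (n : nat) (A : 'M[R]_n)
    (sh : rjcf_shape n) : Prop :=
  exists (a b : 'I_(sh_r sh) -> R) (c : 'I_(sh_s sh) -> R),
    admissible a b c /\ similarity_orbit A (rjcf_mx a b c).

(* The shape of A is unique only up to reordering of the blocks, and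
   reordering does not change the union of orbits; hence [bundle] ranges over
   all the shapes of A instead of choosing one. *)
Definition bundle (R : realType) (n : nat) (A : 'M[R]_n) : set 'M[R]_n :=
  [set X | exists sh : rjcf_shape n, has_rjcf A sh /\
     exists (a b : 'I_(sh_r sh) -> R) (c : 'I_(sh_s sh) -> R),
       admissible a b c /\ similarity_orbit (rjcf_mx a b c) X].

Definition codim_orbit (R : realType) (n : nat) (A : 'M[R]_n) : int :=
  (n ^ 2)%N%:Z - (\dim (limg (linfun (mulmxr A \- mulmx A))))%:Z.

(* The number 2r + s. *)
Definition num_complex_eigenvalues (R : realType) (n : nat) (A : 'M[R]_n) :
    nat :=
  #|` fset_set
        [set z : R[i] | eigenvalue (map_mx (real_complex R) A) z] |%fset.

Definition codim_bundle (R : realType) (n : nat) (A : 'M[R]_n) : int :=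
  codim_orbit A - (num_complex_eigenvalues A)%:Z.

Lemma generic_size (n : nat) (t : 'I_(n./2).+1) :
  (\sum_(i < t) 2 + \sum_(i < n - t.*2) 1)%N = n.
Proof.
rewrite !sum_nat_const !card_ord muln1 muln2 subnKC //.
by rewrite -geq_half_double -ltnS.
Qed.

(* [c_i] is rendered as the 1 x 1 scalar matrix. *)
Definition generic_mx (R : realType) (n : nat) (t : 'I_(n./2).+1)
    (a b : 'I_t -> R) (c : 'I_(n - t.*2) -> R) : 'M[R]_n :=
  castmx (generic_size t, generic_size t)
    (block_mx (\mxdiag_(i < t) blockC (a i) (b i)) 0
              0 (\mxdiag_(i < n - t.*2) (c i)%:M)).

(* Main.v *)
(* Each B_t turns out to be the set of real matrices with n distinct complex
   eigenvalues, exactly n - 2t of which are real.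

   Membership: the roots of the characteristic polynomial of a real Jordan form
   can be read off its parameters, and two real matrices with the same
   characteristic polynomial without multiple roots are similar, both being
   similar to its companion matrix.  Indeed the sum of the eigenvectors is a
   cyclic vector over C, hence some real vector u is cyclic; moreover X |-> u X
   maps the centralizer bijectively onto the row vectors, so that the orbit has
   codimension n.

   Openness: if Y is close to X, every disc of a family of disjoint discs
   centred at the eigenvalues of X contains an eigenvalue of Y, hence exactly
   one.  As both spectra are stable under conjugation, this matching preserves
   realness.  Since the B_t are pairwise disjoint, (ii) follows.

   Density: on the line from any matrix to the diagonal matrix (0, ..., n - 1)
   the discriminant of the characteristic polynomial is a nonzero polynomial in
   the parameter, so matrices with simple spectrum lie arbitrarily close. *)

Require Import Defs.
From mathcomp Require Import all_boot all_order all_algebra.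
From mathcomp Require Import finmap perm separable ring lra.
From mathcomp Require Import all_classical all_reals topology normedtype.
From mathcomp.real_closed Require Import complex.

Set Implicit Arguments.
Unset Strict Implicit.
Unset Printing Implicit Defensive.

Import Order.TTheory GRing.Theory Num.Theory.
Import numFieldNormedType.Exports.

Local Open Scope classical_set_scope.
Local Open Scope ring_scope.

(** * Characteristic polynomials of real Jordan forms *)

Lemma char_poly_castmx (R : nzRingType) m n (e : m = n) (A : 'M[R]_m) :
  char_poly (castmx (e, e) A) = char_poly A.
Proof. by case: n / e; rewrite castmx_id. Qed.

Lemma char_poly_ublock (R : comNzRingType) m n (A : 'M[R]_m) (B : 'M[R]_(m, n))
    (D : 'M[R]_n) :
  char_poly (block_mx A B 0 D) = char_poly A * char_poly D.
Proof.
rewrite /char_poly /char_poly_mx map_block_mx map_mx0 (scalar_mx_block m n 'X).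
by rewrite opp_block_mx add_block_mx oppr0 addr0 det_ublock.
Qed.

(** Induction on the number of blocks: once the first diagonal block is split off, the column below
    it vanishes and the determinant factors. *)
Lemma char_poly_utrig_mxblock (R : comNzRingType) m (p_ : 'I_m -> nat)
    (B_ : forall i j, 'M[R]_(p_ i, p_ j)) :
    (forall i j : 'I_m, (j < i)%N -> B_ i j = 0) ->
  char_poly (\mxblock_(i, j) B_ i j) = \prod_i char_poly (B_ i i).
Proof.
elim: m p_ B_ => [|m IH] p_ B_ B0.
  rewrite [RHS]big_ord0; have A0 n (A : 'M[R]_n) : n = 0%N -> char_poly A = 1.
    by move=> n0; rewrite n0 in A *; rewrite /char_poly det_mx00.
  by apply: A0; rewrite big_ord0.
rewrite mxblock_recul char_poly_castmx.
have -> : \mxcol_i B_ (lift ord0 i) ord0 = 0.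
  by rewrite -[RHS]mxcol0; apply: eq_mxcol => i; apply: B0.
rewrite char_poly_ublock big_ord_recl IH // => i j ji.
exact: B0.
Qed.

Lemma char_poly_mxdiag (R : comNzRingType) m (p_ : 'I_m -> nat)
    (B_ : forall i, 'M[R]_(p_ i)) :
  char_poly (\mxdiag_i B_ i) = \prod_i char_poly (B_ i).
Proof.
rewrite char_poly_utrig_mxblock; last first.
  by move=> i j ji; case: eqVneq ji => // ->; rewrite ltnn.
by apply: eq_bigr => i _; rewrite eqxx conform_mx_id.
Qed.

Lemma blockCE (R : realType) (a b : R) i j :
  blockC a b i j = if i == j then a else if (i < j)%N then b else - b.
Proof.
rewrite /blockC mxE -val_eqE.
by case: splitP => i' /= ->; rewrite mxE; case: splitP => j' /= ->;
  rewrite mxE !ord1 /= ?mulr1n.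
Qed.

Lemma char_poly_blockC (R : realType) (a b : R) :
  char_poly (blockC a b) = ('X - a%:P) ^+ 2 + (b ^+ 2)%:P.
Proof.
move: (blockC a b) (blockCE a b) => C CE.
rewrite /char_poly (expand_det_row _ 0) !big_ord_recl big_ord0 /cofactor.
rewrite !det_mx11 !mxE !CE /= !expr0 !mulr1n !mulr0n addr0 mul1r expr1.
rewrite !polyCN polyC_exp. ring.
Qed.

Lemma char_poly_blockCk (R : realType) k (a b : R) :
  char_poly (blockCk k a b) = (('X - a%:P) ^+ 2 + (b ^+ 2)%:P) ^+ k.
Proof.
rewrite char_poly_utrig_mxblock => [|i j ji].
  rewrite (eq_bigr (fun=> char_poly (blockC a b))) => [|i _].
    by rewrite prodr_const card_ord char_poly_blockC.
  by rewrite eqxx.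
by rewrite -val_eqE !gtn_eqF // (ltn_trans ji).
Qed.

Lemma char_poly_blockJ (R : realType) k (c : R) :
  char_poly (blockJ k c) = ('X - c%:P) ^+ k.
Proof.
rewrite /char_poly -det_tr det_trig; last first.
  apply/is_trig_mxP => i j ij; rewrite !mxE -!val_eqE gtn_eqF //=.
  by rewrite gtn_eqF ?subrr // (ltn_trans ij).
rewrite (eq_bigr (fun=> 'X - c%:P)) => [|i _]; last by rewrite !mxE eqxx.
by rewrite prodr_const card_ord.
Qed.

(** For admissible parameters each eigenvalue appears once, however many Jordan blocks carry it. *)
Definition spectrum_of (R : realType) r s (a b : 'I_r -> R) (c : 'I_s -> R) :
    seq R[i] :=
  [seq (a i +i* b i)%C | i <- fintype.enum 'I_r] ++
  [seq (a i -i* b i)%C | i <- fintype.enum 'I_r] ++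
  [seq (c i)%:C%C | i <- fintype.enum 'I_s].

Definition charpolyC (R : realType) n (A : 'M[R]_n) : {poly R[i]} :=
  map_poly (real_complex R) (char_poly A).

Lemma size_charpolyC (R : realType) n (A : 'M[R]_n) : size (charpolyC A) = n.+1.
Proof. by rewrite size_map_poly size_char_poly. Qed.

Lemma charpolyC_monic (R : realType) n (A : 'M[R]_n) : charpolyC A \is monic.
Proof. by rewrite map_monic char_poly_monic. Qed.

Lemma root_charpoly_blockC (R : realType) (a b : R) z :
  root (map_poly (real_complex R) (('X - a%:P) ^+ 2 + (b ^+ 2)%:P)) z
    = (z == (a +i* b)%C) || (z == (a -i* b)%C).
Proof.
rewrite rootE -(subr_eq0 z (_ +i* _)%C) -(subr_eq0 z (_ -i* _)%C) -mulf_eq0.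
rewrite rmorphD rmorphXn /= rmorphB /= map_polyX !map_polyC !hornerE /=.
congr (_ == 0); case: z => x y; apply/eqP; rewrite eq_complex expr2.
simpc => /=.
by apply/andP; split; apply/eqP; ring.
Qed.

Lemma root_prod_fin (F : fieldType) (I : finType) (p : I -> {poly F}) z :
  root (\prod_i p i) z = [exists i, root (p i) z].
Proof.
rewrite rootE horner_prod; apply/prodf_eq0/existsP => [[i _ h]| [i h]];
by exists i.
Qed.

Lemma exists_mem_map (I : finType) (T : eqType) (P : pred I) (f : I -> T) z :
  (forall i, P i = (z == f i)) ->
  [exists i, P i] = (z \in [seq f i | i <- fintype.enum I]).
Proof.
move=> Pf; apply/existsP/mapP => [[k]|[k _ zk]].
  by rewrite Pf => /eqP->; exists k; rewrite // mem_enum.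
by exists k; rewrite Pf zk eqxx.
Qed.

Lemma exists_mem_map2 (I : finType) (T : eqType) (P : pred I) (f g : I -> T) z :
  (forall i, P i = (z == f i) || (z == g i)) ->
  [exists i, P i] =
    (z \in [seq f i | i <- fintype.enum I]) ||
    (z \in [seq g i | i <- fintype.enum I]).
Proof.
move=> Pf; rewrite -(@exists_mem_map _ _ (fun i => z == f i)) //.
rewrite -(@exists_mem_map _ _ (fun i => z == g i)) //.
apply/existsP/orP => [[k]|[/existsP[k]|/existsP[k]]].
- by rewrite Pf => /orP[] zk; [left|right]; apply/existsP; exists k.
- by move=> zk; exists k; rewrite Pf zk.
- by move=> zk; exists k; rewrite Pf zk orbT.
Qed.

(** The number and sizes of the blocks affect only multiplicities, as every eigenvalue carries at
    least one block of positive size. *)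
Lemma root_rjcf (R : realType) n (sh : rjcf_shape n)
    (a b : 'I_(sh_r sh) -> R) c z :
  root (charpolyC (rjcf_mx a b c)) z = (z \in spectrum_of a b c).
Proof.
rewrite /charpolyC /rjcf_mx char_poly_castmx char_poly_ublock !char_poly_mxdiag.
rewrite rmorphM !rmorph_prod /= rootM !root_prod_fin !mem_cat orbA.
have rE i : root (map_poly (real_complex R)
      (char_poly (\mxdiag_(j < sh_d i) blockCk (sh_l j) (a i) (b i)))) z =
    (z == (a i +i* b i)%C) || (z == (a i -i* b i)%C).
  rewrite char_poly_mxdiag rmorph_prod root_prod_fin -root_charpoly_blockC.
  have rj (j : 'I_(sh_d i)) := sh_l_gt0 j.
  apply/existsP/idP => [[j]|rz]; last exists (Ordinal (sh_d_gt0 i));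
    by rewrite char_poly_blockCk rmorphXn /= root_exp ?rj //; apply: mulrC.
have rJ i : root (map_poly (real_complex R)
      (char_poly (\mxdiag_(j < sh_e i) blockJ (sh_k j) (c i)))) z =
    (z == (c i)%:C%C).
  rewrite char_poly_mxdiag rmorph_prod root_prod_fin -root_XsubC.
  have rj (j : 'I_(sh_e i)) := sh_k_gt0 j.
  apply/existsP/idP => [[j]|rz]; last exists (Ordinal (sh_e_gt0 i));
    by rewrite char_poly_blockJ rmorphXn /= rmorphB /= map_polyX map_polyC
      root_exp ?rj //; apply: mulrC.
by congr (_ || _); [exact: exists_mem_map2|exact: exists_mem_map].
Qed.

Lemma root_generic_mx (R : realType) n (t : 'I_(n./2).+1)
    (a b : 'I_t -> R) c z :
  root (charpolyC (generic_mx a b c)) z = (z \in spectrum_of a b c).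
Proof.
rewrite /charpolyC /generic_mx char_poly_castmx char_poly_ublock.
rewrite !char_poly_mxdiag.
rewrite rmorphM !rmorph_prod /= rootM !root_prod_fin !mem_cat orbA.
congr (_ || _).
  apply: exists_mem_map2 => k.
  by rewrite char_poly_blockC root_charpoly_blockC.
apply: exists_mem_map => k; rewrite char_poly_trig ?scalar_mx_is_trig //.
by rewrite big_ord1 !mxE rmorphB /= map_polyX map_polyC root_XsubC.
Qed.

Lemma size_spectrum_of (R : realType) r s (a b : 'I_r -> R) (c : 'I_s -> R) :
  size (spectrum_of a b c) = (r.*2 + s)%N.
Proof.
rewrite !size_cat !(size_map _ (fintype.enum _)) -!cardE !card_ord.
by rewrite addnA addnn.
Qed.

(** The sign of the imaginary part separates the three lists; inside each list admissibility
    does. *)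
Lemma uniq_spectrum_of (R : realType) r s (a b : 'I_r -> R) (c : 'I_s -> R) :
  admissible a b c -> uniq (spectrum_of a b c).
Proof.
case=> b0 ab cc; rewrite !cat_uniq.
apply/and3P; split; last (apply/and3P; split).
- rewrite map_inj_uniq ?fintype.enum_uniq // => i j [] e e'.
  by apply/eqP/negPn/negP => /ab; rewrite e e' eqxx.
- apply/hasPn => z; rewrite mem_cat => /orP[] /mapP[i _ ->] /=; apply/mapP.
    by move=> [j _ [_ e]]; have := b0 i; have := b0 j; lra.
  by move=> [j _ [_ e]]; have := b0 j; lra.
- rewrite map_inj_uniq ?fintype.enum_uniq // => i j [] e /oppr_inj e'.
  by apply/eqP/negPn/negP => /ab; rewrite e e' eqxx.
- apply/hasPn => z /mapP[i _ ->] /=; apply/mapP.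
  by move=> [j _ [_ e]]; have := b0 j; lra.
- rewrite map_inj_uniq ?fintype.enum_uniq // => i j [] e.
  by apply/eqP/negPn/negP => /cc; rewrite e eqxx.
Qed.

Lemma count_spectrum_of (R : realType) r s (a b : 'I_r -> R) (c : 'I_s -> R) :
  admissible a b c ->
  count (fun z => complex.Im z == 0) (spectrum_of a b c) = s.
Proof.
case=> b0 _ _; rewrite !count_cat.
have count0 (f : 'I_r -> R[i]) : (forall i, complex.Im (f i) != 0) ->
    count (fun z => complex.Im z == 0) [seq f i | i <- fintype.enum 'I_r] = 0%N.
  move=> f0; apply/eqP; rewrite -leqn0 leqNgt -has_count.
  by apply/hasPn => _ /mapP[i _ ->]; apply: f0.
rewrite !count0 => [|i|i] /=; rewrite ?oppr_eq0 ?gt_eqF //.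
rewrite count_map (@eq_in_count _ _ predT) ?count_predT -?cardE ?card_ord //.
by move=> i _; apply: eqxx.
Qed.

(** * Cyclic vectors *)

Section Krylov.
Variables (F : fieldType) (n : nat).
Implicit Types (A B X : 'M[F]_n.+1) (u : 'rV[F]_n.+1).

(** Invertible exactly when [u] is a cyclic row vector for [A]. *)
Definition krylov A u : 'M[F]_n.+1 := \matrix_(i < n.+1) (u *m A ^+ i).

Lemma mulmx_exprSr A k : A ^+ k *m A = A ^+ k.+1.
Proof. by rewrite exprSr. Qed.

Lemma mul_krylov A u (w : 'rV_n.+1) :
  w *m krylov A u = u *m (\sum_i w 0 i *: A ^+ i).
Proof.
rewrite mulmx_sum_row mulmx_sumr; apply: eq_bigr => i _.
by rewrite rowK scalemxAr.
Qed.

(** The Krylov matrix of a sum of eigenvectors is a Vandermonde matrix times the matrix of these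
    eigenvectors. *)
Lemma distinct_roots_cyclic A (rs : seq F) :
    uniq rs -> size rs = n.+1 -> all (root (char_poly A)) rs ->
  exists u, krylov A u \in unitmx.
Proof.
move=> urs srs /allP rsP.
have /fin_all_exists2[v vA v0] (i : 'I_n.+1) :
    exists2 v : 'rV_n.+1, v *m A = rs`_i *: v & v != 0.
  by apply/eigenvalueP; rewrite eigenvalue_root_char rsP ?mem_nth ?srs.
have vAk i k : v i *m A ^+ k = rs`_i ^+ k *: v i.
  elim: k => [|k IH]; first by rewrite !expr0 mulmx1 scale1r.
  by rewrite exprSr mulmxA IH -scalemxAl vA scalerA -exprSr.
pose Vm := Vandermonde n.+1 (\row_(i < n.+1) rs`_i).
have Vm_unit : Vm \in unitmx.
  rewrite unitmxE det_Vandermonde unitfE; apply/prodf_neq0 => i _.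
  apply/prodf_neq0 => j ij; rewrite !mxE subr_eq0 nth_uniq ?srs //.
  by rewrite gtn_eqF.
pose V := \matrix_i v i.
have V_unit : V \in unitmx.
  (* Independence of the eigenvectors: multiplying a relation by the powers of [A] gives a
     Vandermonde system in the vectors [x 0 i *: v i]. *)
  rewrite -row_free_unit -kermx_eq0; apply/rowV0P => x /sub_kermxP xV.
  have /(canRL (mulKmx Vm_unit)) : Vm *m (\matrix_i (x 0 i *: v i)) = 0.
    apply/row_matrixP => k; rewrite row_mul row0.
    transitivity (x *m V *m A ^+ k); last by rewrite xV mul0mx.
    rewrite mulmx_sum_row (mulmx_sum_row x) mulmx_suml.
    apply: eq_bigr => i _; rewrite !mxE !rowK -scalemxAl vAk.
    by rewrite !scalerA mulrC.
  rewrite mulmx0 => /row_matrixP x0; apply/rowP => i; apply/eqP.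
  have /eqP := x0 i; rewrite rowK row0 scaler_eq0 (negPf (v0 i)) orbF.
  by rewrite [(0 : 'rV_ _) _ _]mxE.
exists (\sum_i v i).
suff -> : krylov A (\sum_i v i) = Vm *m V by rewrite unitmx_mul Vm_unit.
apply/row_matrixP => k; rewrite rowK row_mul (mulmx_sum_row (row k Vm)).
rewrite mulmx_suml.
by apply: eq_bigr => i _; rewrite vAk rowK !mxE.
Qed.

Definition companion_of (p : {poly F}) : 'M[F]_n.+1 :=
  \matrix_(i, j) (if i == ord_max then - p`_j else (j == i.+1 :> nat)%:R).

(** Multiplication by [A] shifts the rows by one; Cayley-Hamilton rewrites the image of the last
    row. *)
Lemma krylov_companion A u :
  krylov A u *m A = companion_of (char_poly A) *m krylov A u.
Proof.
apply/row_matrixP => i; rewrite !row_mul rowK -mulmxA mulmx_exprSr mul_krylov.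
congr (_ *m _); case: (eqVneq i ord_max) => [->|i_max].
  have := Cayley_Hamilton A.
  rewrite -[X in horner_mx A X]coefK poly_def size_char_poly linear_sum /=.
  under eq_bigr => j _ do rewrite linearZ rmorphXn /= horner_mx_X.
  rewrite big_ord_recr /=; have := monicP (char_poly_monic A).
  rewrite /lead_coef size_char_poly => ->; rewrite scale1r => /eqP.
  rewrite addrC addr_eq0 => /eqP ->; rewrite -sumrN; apply: eq_bigr => j _.
  by rewrite !mxE eqxx scaleNr.
have i_lt : (i.+1 < n.+1)%N.
  by rewrite ltnS ltn_neqAle -ltnS ltn_ord andbT; move: i_max; rewrite -val_eqE.
rewrite (bigD1 (Ordinal i_lt)) //= !mxE (negPf i_max) eqxx scale1r.
rewrite big1 ?addr0 // => j; rewrite -val_eqE /= => ji.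
by rewrite !mxE (negPf i_max) (negPf ji) scale0r.
Qed.

(** The two Krylov matrices conjugate [A] and [B] to the same companion matrix. *)
Lemma cyclic_similar A B u v :
    char_poly A = char_poly B -> krylov A u \in unitmx ->
    krylov B v \in unitmx ->
  exists2 P, P \in unitmx & invmx P *m A *m P = B.
Proof.
move=> AB uA uB; set P := invmx (krylov A u) *m krylov B v.
have uP : P \in unitmx by rewrite unitmx_mul unitmx_inv uA.
exists P => //; suff AP : A *m P = P *m B by rewrite -mulmxA AP mulKmx.
rewrite -[RHS]mulmxA krylov_companion -AB mulmxA.
rewrite -[companion_of _](mulmxK uA) -krylov_companion.
by rewrite !mulmxA mulVmx // mul1mx.
Qed.

Lemma dim_centralizer A u : krylov A u \in unitmx ->
  \dim (lker (linfun (mulmxr A \- mulmx A))) = n.+1.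
Proof.
move=> uA; set f := linfun _.
pose g := linfun (mulmx u : 'M[F]_n.+1 -> 'rV_n.+1).
have fE X : (X \in lker f) = (X *m A == A *m X).
  by rewrite memv_ker lfunE /= subr_eq0.
rewrite -(limg_dim_eq (f := g)).
  suff -> : (g @: lker f)%VS = fullv by rewrite dimvf; apply: mul1n.
  apply/eqP; rewrite eqEsubv subvf; apply/subvP => w _; apply/memv_imgP.
  (* Surjectivity: [w] is [u] times a polynomial in [A], whose coefficients are the coordinates of
     [w] in the Krylov basis. *)
  exists (\sum_i (w *m invmx (krylov A u)) 0 i *: A ^+ i).
    rewrite fE mulmx_suml mulmx_sumr; apply/eqP/eq_bigr => i _.
    by rewrite -scalemxAl -scalemxAr mulmx_exprSr exprS.
  by rewrite lfunE /= -mul_krylov mulmxKV.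
(* Injectivity: if [X] commutes with [A] and [u *m X = 0], then [X] kills every row of the Krylov
   matrix. *)
apply/eqP; rewrite -subv0; apply/subvP => X.
rewrite memv_cap fE memv_ker lfunE /=.
case/andP=> /eqP XA /eqP uX; rewrite memv0.
have XAk k : X *m A ^+ k = A ^+ k *m X.
  elim: k => [|k IH]; first by rewrite !expr0 mulmx1 mul1mx.
  by rewrite -mulmx_exprSr mulmxA IH -!mulmxA XA.
apply/eqP; rewrite -[X](mulKmx uA); apply/(canLR (mulKmx uA)); rewrite mulmx0.
apply/row_matrixP => i; rewrite row_mul rowK row0 -mulmxA -XAk mulmxA uX.
by rewrite mul0mx.
Qed.

End Krylov.

(** A nonzero polynomial cannot vanish at all the points [e / (k + 2)]; the shift by 2 keeps them
    strictly below [e], even for [k = 0]. *)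
Lemma small_nonroot (R : realFieldType) (p : {poly R}) (e : R) :
  p != 0 -> 0 < e -> exists s, [/\ 0 < s, s < e & p.[s] != 0].
Proof.
move=> p0 e0; pose x k : R := e / k.+2%:R.
have x_inj : injective x.
  move=> i j /(mulfI (lt0r_neq0 e0)) /invr_inj /eqP.
  by rewrite eqr_nat => /eqP [].
have [k kP] : exists k, ~~ root p (x k).
  apply: contrapT => /forallNP xp.
  have rootx : all (root p) [seq x k | k <- iota 0 (size p)].
    by apply/allP => _ /mapP[k _ ->]; apply/negPn/negP/xp.
  have := max_poly_roots p0 rootx.
  by rewrite map_inj_uniq // iota_uniq size_map size_iota ltnn => /(_ isT).
exists (x k); split => //; first by rewrite divr_gt0 ?ltr0n.
by rewrite ltr_pdivrMr ?ltr0n // ltr_pMr // ltr1n.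
Qed.

(** * Real cyclic vectors and similarity over the reals *)

Section RealSpectrum.
Variable R : realType.
Local Notation toC := (real_complex R).

Lemma krylov_map n (A : 'M[R]_n.+1) (u : 'rV[R]_n.+1) :
  krylov (map_mx toC A) (map_mx toC u) = map_mx toC (krylov A u).
Proof. by apply/row_matrixP => i; rewrite -map_row !rowK map_mxM rmorphXn. Qed.

Lemma krylovD (F : fieldType) n (A : 'M[F]_n.+1) (u v : 'rV[F]_n.+1) (s : F) :
  krylov A (u + s *: v) = krylov A u + s *: krylov A v.
Proof.
apply/row_matrixP => i.
by rewrite linearD linearZ /= !rowK mulmxDl scalemxAl.
Qed.

(* The determinant of the Krylov matrix of u1 + s u2 is a polynomial in s that
   does not vanish at s = 'i, hence not at some real s. *)
Lemma real_cyclic n (A : 'M[R]_n.+1) (rs : seq R[i]) :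
    uniq rs -> size rs = n.+1 -> all (root (charpolyC A)) rs ->
  exists u, krylov A u \in unitmx.
Proof.
move=> urs srs; rewrite /charpolyC map_char_poly => rsP.
have [u] := distinct_roots_cyclic urs srs rsP.
pose u1 := map_mx (@complex.Re R) u; pose u2 := map_mx (@complex.Im R) u.
have -> : u = map_mx toC u1 + 'i%C *: map_mx toC u2.
  by apply/matrixP => i j; rewrite !mxE -complexE.
rewrite krylovD !krylov_map unitmxE unitfE => detC.
pose K := map_mx polyC (krylov A u1) + 'X *: map_mx polyC (krylov A u2).
have detK s : (\det K).[s] = \det (krylov A (u1 + s *: u2)).
  rewrite krylovD /K -horner_evalE -det_map_mx.
  move: (krylov A u1) (krylov A u2) => K1 K2; congr (\det _).
  by apply/matrixP => i j; rewrite !mxE /= !(horner_evalE, hornerE).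
have K0 : \det K != 0.
  apply: contra_neq detC => K0.
  (* Evaluation at ['i] gives back the Krylov determinant of the complex vector [u]. *)
  transitivity ((map_poly toC (\det K)).['i%C]); last first.
    by rewrite K0 rmorph0 horner0.
  rewrite /K -horner_evalE -!det_map_mx.
  move: (krylov A u1) (krylov A u2) => K1 K2; congr (\det _).
  apply/matrixP => i j; rewrite !mxE /= horner_evalE rmorphD rmorphM /=.
  by rewrite map_polyX !map_polyC !hornerE.
have [s [_ _ sP]] := small_nonroot K0 ltr01.
by exists (u1 + s *: u2); rewrite unitmxE unitfE -detK.
Qed.

Lemma charpolyC_distinct n (A : 'M[R]_n) rs :
    uniq rs -> size rs = n -> all (root (charpolyC A)) rs ->
  charpolyC A = \prod_(z <- rs) ('X - z%:P).
Proof.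
move=> urs srs rsP; rewrite [LHS](@all_roots_prod_XsubC _ _ rs) //.
- by rewrite (monicP (charpolyC_monic A)) scale1r.
- by rewrite size_charpolyC srs.
- by rewrite uniq_rootsE.
Qed.

Lemma charpolyC_inj n (A B : 'M[R]_n) :
  charpolyC A = charpolyC B -> char_poly A = char_poly B.
Proof. exact: map_poly_inj. Qed.

Lemma similarity_orbit_char_poly n (A X : 'M[R]_n) :
  similarity_orbit A X -> char_poly X = char_poly A.
Proof.
case=> P /= uP <-; rewrite /char_poly.
have -> : char_poly_mx (invmx P *m A *m P) =
    map_mx polyC (invmx P) *m char_poly_mx A *m map_mx polyC P.
  rewrite /char_poly_mx mulmxBr mulmxBl -!map_mxM; congr (_ - _).
  by rewrite scalar_mxC -mulmxA -map_mxM mulVmx // map_mx1 mulmx1.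
rewrite !det_mulmx mulrAC -det_mulmx -map_mxM mulVmx //.
by rewrite map_mx1 det1 mul1r.
Qed.

(** Both matrices have a real cyclic vector, so equality of the characteristic polynomials yields a
    real conjugation. *)
Lemma similarity_orbit_distinct n (A X : 'M[R]_n) rs :
    (0 < n)%N -> uniq rs ->
    charpolyC A = \prod_(z <- rs) ('X - z%:P) -> charpolyC X = charpolyC A ->
  similarity_orbit A X.
Proof.
case: n A X => // n A X _ urs Ars XA.
have srs : size rs = n.+1.
  by apply: succn_inj; rewrite -(size_charpolyC A) Ars size_prod_XsubC.
have rsP : all (root (charpolyC A)) rs.
  by apply/allP => z; rewrite Ars root_prod_XsubC.
have [u uA] := real_cyclic urs srs rsP.
rewrite -XA in rsP; have [v vX] := real_cyclic urs srs rsP.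
have [P uP PX] := cyclic_similar (esym (charpolyC_inj XA)) uA vX.
by exists P.
Qed.

End RealSpectrum.

(** * Bundles as sets of matrices with simple spectrum *)

Section Bundle.
Variable R : realType.

(** The factorization forces [rs] to have [n] terms: [n] distinct complex eigenvalues, [s] of them
    real. *)
Definition simple_spectrum n (s : nat) : set 'M[R]_n :=
  [set X | exists rs : seq R[i], [/\ uniq rs,
     charpolyC X = \prod_(z <- rs) ('X - z%:P)
   & count (fun z => complex.Im z == 0) rs = s]].

Lemma root_charpolyC_conj n (X : 'M[R]_n) z :
  root (charpolyC X) (conjc z) = root (charpolyC X) z.
Proof.
have conjP : map_poly (@conjc R) (charpolyC X) = charpolyC X.
  rewrite /charpolyC -map_poly_comp.
  by apply: eq_map_poly => x /=; rewrite oppr0.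
by rewrite -{1}conjP complex_root_conj conjcK.
Qed.

Lemma simple_spectrum_size n (X : 'M[R]_n) (rs : seq R[i]) :
  charpolyC X = \prod_(z <- rs) ('X - z%:P) -> size rs = n.
Proof.
move=> Xrs; apply: succn_inj.
by rewrite -(size_charpolyC X) Xrs size_prod_XsubC.
Qed.

(** Conjugation exchanges the elements of the upper and lower half-planes. *)
Lemma size_conj_closed (rs : seq R[i]) :
    uniq rs -> (forall z, z \in rs -> conjc z \in rs) ->
  size rs = ((count (fun z => (0 < complex.Im z)%R) rs).*2 +
             count (fun z => complex.Im z == 0%R) rs)%N.
Proof.
move=> urs rsJ.
have -> : count (fun z => complex.Im z == 0) rs =
    (size rs - count (fun z => complex.Im z != 0%R) rs)%N.
  by rewrite -(count_predC (fun z => complex.Im z == 0) rs) addnK.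
suff <- : count (fun z => complex.Im z != 0) rs =
    (count (fun z => (0 < complex.Im z)%R) rs).*2.
  by rewrite subnKC // count_size.
have PL : count (fun z => (0 < complex.Im z)%R) rs =
          count (fun z => (complex.Im z < 0)%R) rs.
  rewrite -!size_filter -(size_map (@conjc R)).
  apply: perm_size; apply: uniq_perm.
  - by rewrite map_inj_uniq ?filter_uniq //; apply: (can_inj (@conjcK R)).
  - exact: filter_uniq.
  move=> z; rewrite mem_filter; apply/mapP/andP => [[w]|[z0 zrs]].
    rewrite mem_filter => /andP[w0 wrs ->]; split; last exact: rsJ.
    by case: w w0 {wrs} => x y /=; rewrite oppr_lt0.
  exists (conjc z); last by rewrite conjcK.
  rewrite mem_filter rsJ // andbT.
  by case: z z0 {zrs} => x y /=; rewrite oppr_gt0.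
rewrite -addnn {2}PL -count_predUI.
rewrite [X in (_ + X)%N](@eq_count _ _ pred0) ?count_pred0 ?addn0.
  by apply: eq_count => z /=; rewrite neq_lt orbC.
by move=> z /=; case: ltrgtP.
Qed.

(** The elements in the upper half-plane provide [a] and [b], the real ones provide [c]. *)
Lemma conj_closed_spectrum r s (rs : seq R[i]) :
    uniq rs -> size rs = (r.*2 + s)%N ->
    (forall z, z \in rs -> conjc z \in rs) ->
    count (fun z => complex.Im z == 0) rs = s ->
  exists (a b : 'I_r -> R) (c : 'I_s -> R),
    admissible a b c /\ {subset spectrum_of a b c <= rs}.
Proof.
move=> urs srs rsJ crs.
pose U := [seq z <- rs | 0 < complex.Im z].
pose C := [seq z <- rs | complex.Im z == 0].
have sC : size C = s by rewrite size_filter.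
have sU : size U = r.
  have /eqP := size_conj_closed urs rsJ.
  by rewrite srs crs eqn_add2r => /eqP/double_inj ->; rewrite size_filter.
have Ui (i : 'I_r) : U`_i \in U by rewrite mem_nth ?sU ?ltn_ord.
have Ci (i : 'I_s) : C`_i \in C by rewrite mem_nth ?sC ?ltn_ord.
have Uuniq : uniq U := filter_uniq _ urs.
have Cuniq : uniq C := filter_uniq _ urs.
exists (fun i => complex.Re U`_i), (fun i => complex.Im U`_i).
exists (fun i => complex.Re C`_i); split; [split|].
- by move=> i; have := Ui i; rewrite mem_filter => /andP[].
- move=> i j; apply: contraNneq => -[e e']; apply/eqP/val_inj/eqP.
  rewrite -(nth_uniq 0 _ _ Uuniq) ?sU ?ltn_ord //; apply/eqP.
  by apply/eqP; rewrite eq_complex e e' !eqxx.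
- move=> i j; apply: contraNneq => e; apply/eqP/val_inj/eqP.
  rewrite -(nth_uniq 0 _ _ Cuniq) ?sC ?ltn_ord // eq_complex e eqxx /=.
  have := Ci i; have := Ci j; rewrite !mem_filter.
  by move=> /andP[/eqP-> _] /andP[/eqP-> _].
move=> z; rewrite !mem_cat => /or3P[] /mapP[i _ ->].
- have := Ui i; rewrite mem_filter => /andP[_].
  by case: (U`_i).
- have := Ui i; rewrite mem_filter => /andP[_ /rsJ].
  by case: (U`_i).
- have := Ci i; rewrite mem_filter.
  by case: (C`_i) => x y /andP[/eqP /= ->].
Qed.

Lemma generic_shape_size n (t : 'I_(n./2).+1) :
  (\sum_(i < t) \sum_(j < 1) \sum_(m < 1) 2 +
   \sum_(i < n - t.*2) \sum_(j < 1) 1)%N = n.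
Proof.
rewrite -[RHS](generic_size t); congr (_ + _)%N.
  by apply: eq_bigr => i _; rewrite !big_ord1.
by apply: eq_bigr => i _; rewrite !big_ord1.
Qed.

(** One block of order one per eigenvalue. Forms of this shape are compared with [generic_mx]
    through characteristic polynomials, not entrywise. *)
Definition generic_shape n (t : 'I_(n./2).+1) : rjcf_shape n :=
  @RJCFShape n t (fun=> 1%N) (fun _ _ => 1%N) (n - t.*2) (fun=> 1%N)
    (fun _ _ => 1%N) (fun=> isT) (fun _ _ => isT) (fun=> isT)
    (fun _ _ => isT) (generic_shape_size t).

Lemma generic_dim n (t : 'I_(n./2).+1) : (t.*2 + (n - t.*2))%N = n.
Proof. by rewrite subnKC // -geq_half_double -ltnS. Qed.

Lemma bundle_generic n (t : 'I_(n./2).+1) (a b : 'I_t -> R) c :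
    (0 < n)%N -> admissible a b c ->
  bundle (generic_mx a b c) = simple_spectrum (n - t.*2).
Proof.
move=> n0 adm; set A := generic_mx a b c.
have charA : charpolyC A = \prod_(z <- spectrum_of a b c) ('X - z%:P).
  apply: charpolyC_distinct; first exact: uniq_spectrum_of.
    by rewrite size_spectrum_of generic_dim.
  by apply/allP => z; rewrite root_generic_mx.
apply/seteqP; split=> X /=.
  case=> sh [[a1 [b1 [c1 [adm1 orb1]]]] [a2 [b2 [c2 [adm2 orb2]]]]].
  (* Every shape of [A] reproduces its spectrum; comparing lengths and numbers of real elements
     gives [2r + s = n] and [s = n - 2t]. *)
  have roots1 : spectrum_of a1 b1 c1 =i spectrum_of a b c.
    move=> z; rewrite -root_rjcf -root_generic_mx /charpolyC.
    by rewrite (similarity_orbit_char_poly orb1).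
  have perm1 := uniq_perm (uniq_spectrum_of adm1) (uniq_spectrum_of adm) roots1.
  have size1 := perm_size perm1.
  rewrite !size_spectrum_of generic_dim in size1.
  have /seq.permP/(_ (fun z => complex.Im z == 0)) := perm1.
  rewrite !count_spectrum_of // => count1.
  exists (spectrum_of a2 b2 c2); split; first exact: uniq_spectrum_of.
    apply: charpolyC_distinct; first exact: uniq_spectrum_of.
      by rewrite size_spectrum_of.
    apply/allP => z; rewrite -root_rjcf /charpolyC.
    by rewrite (similarity_orbit_char_poly orb2).
  by rewrite count_spectrum_of.
case=> rs [urs Xrs crs]; have srs := simple_spectrum_size Xrs.
have rsE z : (z \in rs) = root (charpolyC X) z by rewrite Xrs root_prod_XsubC.
have rsJ z : z \in rs -> conjc z \in rs by rewrite !rsE root_charpolyC_conj.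
(* Conversely, the conjugation-stable spectrum of [X] provides the parameters of a form of generic
   shape. *)
rewrite -[RHS](generic_dim t) in srs.
have [a' [b' [c' [adm' sub']]]] := conj_closed_spectrum urs srs rsJ crs.
have rjE (a1 b1 : 'I_t -> R) c1 : admissible a1 b1 c1 ->
    charpolyC (@rjcf_mx R n (generic_shape t) a1 b1 c1) =
    \prod_(z <- spectrum_of a1 b1 c1) ('X - z%:P).
  move=> adm1; apply: charpolyC_distinct; first exact: uniq_spectrum_of.
    by rewrite size_spectrum_of generic_dim.
  by apply/allP => z zs; rewrite root_rjcf.
exists (generic_shape t); split.
  exists a, b, c; split => //.
  apply: (similarity_orbit_distinct n0 (uniq_spectrum_of adm) charA).
  by rewrite rjE.
exists a', b', c'; split => //.
apply: (similarity_orbit_distinct n0 (uniq_spectrum_of adm') (rjE _ _ _ adm')).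
rewrite rjE //; apply: charpolyC_distinct; first exact: uniq_spectrum_of.
  by rewrite size_spectrum_of generic_dim.
by apply/allP => z /sub'; rewrite rsE.
Qed.

Lemma simple_spectrum_disjoint n s s' (X : 'M[R]_n) :
  simple_spectrum s X -> simple_spectrum s' X -> s = s'.
Proof.
move=> [rs [urs Xrs <-]] [rs' [urs' Xrs' <-]].
suff /seq.permP : perm_eq rs rs' by [].
by apply: uniq_perm => // z; rewrite -!root_prod_XsubC -Xrs -Xrs'.
Qed.

(** By rank-nullity the codimension of the orbit is the dimension of the centralizer, namely [n],
    which the [n] distinct eigenvalues cancel. *)
Lemma codim_bundle_simple n s (X : 'M[R]_n) :
  (0 < n)%N -> simple_spectrum s X -> codim_bundle X = 0.
Proof.
case: n X => // n X _ [rs [urs Xrs _]]; have srs := simple_spectrum_size Xrs.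
have rsP : all (root (charpolyC X)) rs.
  by apply/allP => z; rewrite Xrs root_prod_XsubC.
have [u uX] := real_cyclic urs srs rsP.
rewrite /codim_bundle /codim_orbit.
have /= := limg_ker_dim (linfun (mulmxr X \- mulmx X)) fullv.
rewrite capfv (dim_centralizer uX) dimvf.
have -> : num_complex_eigenvalues X = n.+1.
  rewrite /num_complex_eigenvalues.
  have -> : [set z : R[i] | eigenvalue (map_mx (real_complex R) X) z] =
      [set` [fset z in rs]%fset].
    apply/seteqP; split => z /=;
    by rewrite inE eigenvalue_root_char -map_char_poly
      -[map_poly _ _]/(charpolyC X) Xrs root_prod_XsubC.
  by rewrite set_fsetK card_fseq undup_id.
rewrite [dim _]mulnn => <-; rewrite PoszD; ring.
Qed.

End Bundle.

(** * Openness *)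

Section Topology.
Variable R : realType.
Local Notation toC := (real_complex R).

Lemma seq_lower_bound (s : seq R) :
  (forall x, x \in s -> 0 < x) ->
  exists2 e, 0 < e & forall x, x \in s -> e <= x.
Proof.
elim: s => [|y s IH] s0; first by exists 1.
have [|e e0 es] := IH; first by move=> x xs; apply: s0; rewrite inE xs orbT.
exists (Num.min y e); first by rewrite lt_min e0 s0 ?mem_head.
move=> x; rewrite inE => /predU1P[->|/es ex]; first by rewrite ge_min lexx.
by rewrite ge_min ex orbT.
Qed.

Lemma norm_toC (z : R[i]) : `|z| = toC (complex.Re `|z|).
Proof. by rewrite RRe_real // normr_real. Qed.

(** Makes the open discs of radius [e] centred at distinct elements of [rs] disjoint. *)
Lemma separation (rs : seq R[i]) :
  exists2 e : R, 0 < e &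
    forall z w, z \in rs -> w \in rs -> z != w -> toC e + toC e <= `|z - w|.
Proof.
have [|e e0 es] := seq_lower_bound
  (s := [seq complex.Re `|p.1 - p.2| |
           p <- [seq p <- allpairs pair rs rs | p.1 != p.2]]).
  move=> x /mapP[p]; rewrite mem_filter => /andP[p12 _] ->.
  by rewrite -ltcR -norm_toC normr_gt0 subr_eq0.
exists (e / 2) => [|z w zrs wrs zw]; first by rewrite divr_gt0.
rewrite -rmorphD -splitr norm_toC lecR; apply: es.
apply/mapP; exists (z, w) => //; rewrite mem_filter zw /=.
exact: allpairs_f.
Qed.

Lemma le_expr_prod (F : numDomainType) (T : eqType) (c : F) (f : T -> F)
    (s : seq T) :
    0 <= c -> (forall x, x \in s -> c <= f x) ->
  c ^+ size s <= \prod_(x <- s) f x.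
Proof.
move=> c0; elim: s => [|x s IH] cf; first by rewrite big_nil.
rewrite big_cons exprS ler_pM ?exprn_ge0 ?cf ?mem_head // IH // => y ys.
by rewrite cf // inE ys orbT.
Qed.

(** Otherwise every factor of the product would have modulus at least [e]. *)
Lemma near_root (ws : seq R[i]) (z : R[i]) (e : R) :
    0 < e -> `|(\prod_(w <- ws) ('X - w%:P)).[z]| < toC e ^+ size ws ->
  exists2 w, w \in ws & `|w - z| < toC e.
Proof.
move=> e0 small; apply: contrapT => far; suff : false by [].
have := lt_irreflexive (toC e ^+ size ws); rewrite (le_lt_trans _ small) //.
rewrite horner_prod normr_prod; apply: le_expr_prod; first by rewrite ler0c ltW.
move=> w ws_w; rewrite !hornerE distrC real_leNgt ?normr_real //; last first.
  by apply/complex_realP; exists e.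
by apply/negP => wz; apply: far; exists w.
Qed.

(** Stated on real and imaginary parts, which reduces everything to real-valued functions. *)
Definition continuousC (T : topologicalType) (f : T -> R[i]) :=
  continuous (fun x => complex.Re (f x)) /\
  continuous (fun x => complex.Im (f x)).

Lemma continuousC_cst (T : topologicalType) z : continuousC (fun _ : T => z).
Proof. by split; apply: cst_continuous. Qed.

Lemma continuousC_add (T : topologicalType) (f g : T -> R[i]) :
  continuousC f -> continuousC g -> continuousC (fun x => f x + g x).
Proof.
move=> [f1 f2] [g1 g2]; split => x.
  rewrite (_ : (fun _ => _) = (fun y => complex.Re (f y) + complex.Re (g y))).
    by apply: cvgD; [exact: f1|exact: g1].
  by apply/funext => y; case: (f y) (g y) => [? ?] [? ?].
rewrite (_ : (fun _ => _) = (fun y => complex.Im (f y) + complex.Im (g y))).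
  by apply: cvgD; [exact: f2|exact: g2].
by apply/funext => y; case: (f y) (g y) => [? ?] [? ?].
Qed.

Lemma continuousC_mul (T : topologicalType) (f g : T -> R[i]) :
  continuousC f -> continuousC g -> continuousC (fun x => f x * g x).
Proof.
move=> [f1 f2] [g1 g2]; split => x.
  rewrite (_ : (fun _ => _) = (fun y => complex.Re (f y) * complex.Re (g y)
                                      - complex.Im (f y) * complex.Im (g y))).
    by apply: cvgB; apply: cvgM; [exact: f1|exact: g1|exact: f2|exact: g2].
  by apply/funext => y; case: (f y) (g y) => [? ?] [? ?].
rewrite (_ : (fun _ => _) = (fun y => complex.Re (f y) * complex.Im (g y)
                                    + complex.Im (f y) * complex.Re (g y))).
  by apply: cvgD; apply: cvgM; [exact: f1|exact: g2|exact: f2|exact: g1].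
by apply/funext => y; case: (f y) (g y) => [? ?] [? ?].
Qed.

Lemma continuousC_sum (T : topologicalType) (I : Type) (r : seq I)
    (F : I -> T -> R[i]) :
  (forall i, continuousC (F i)) -> continuousC (fun x => \sum_(i <- r) F i x).
Proof.
move=> Fc; elim: r => [|i r IH].
  rewrite (_ : (fun _ => _) = fun=> 0); first exact: continuousC_cst.
  by apply/funext => x; rewrite big_nil.
rewrite (_ : (fun _ => _) = (fun x => F i x + \sum_(j <- r) F j x)).
  exact: continuousC_add.
by apply/funext => x; rewrite big_cons.
Qed.

Lemma continuousC_prod (T : topologicalType) (I : Type) (r : seq I)
    (F : I -> T -> R[i]) :
  (forall i, continuousC (F i)) -> continuousC (fun x => \prod_(i <- r) F i x).
Proof.
move=> Fc; elim: r => [|i r IH].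
  rewrite (_ : (fun _ => _) = fun=> 1); first exact: continuousC_cst.
  by apply/funext => x; rewrite big_nil.
rewrite (_ : (fun _ => _) = (fun x => F i x * \prod_(j <- r) F j x)).
  exact: continuousC_mul.
by apply/funext => x; rewrite big_cons.
Qed.

(** By the Leibniz formula the value is a polynomial in the entries of [X]. *)
Lemma continuousC_horner_charpoly n (z : R[i]) :
  continuousC (fun X : 'M[R]_n => (charpolyC X).[z]).
Proof.
have -> : (fun X : 'M[R]_n => (charpolyC X).[z]) = (fun X =>
    \sum_(s : {perm 'I_n}) (-1) ^+ s *
      \prod_i (z *+ (i == s i) - toC (X i (s i)))).
  apply/funext => X; rewrite /charpolyC map_char_poly -horner_evalE -det_map_mx.
  apply: eq_bigr => s _; congr (_ * _); apply: eq_bigr => i _.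
  by rewrite !mxE /= horner_evalE !hornerE hornerMn hornerX.
apply: continuousC_sum => s; apply: continuousC_mul.
  exact: continuousC_cst.
apply: continuousC_prod => i; apply: continuousC_add.
  exact: continuousC_cst.
split; last by rewrite /= oppr0; apply: cst_continuous.
by move=> X; exact: (cvgN (@coord_continuous R n n i (s i) X)).
Qed.

End Topology.

(** * Matching the eigenvalues of nearby matrices *)

Section Openness.
Variable R : realType.
Local Notation toC := (real_complex R).

(** Continuity keeps the real and imaginary parts each below [d / 2] in absolute value. *)
Lemma near_charpolyC_small n (X : 'M[R]_n) (z : R[i]) (d : R) :
    0 < d -> root (charpolyC X) z ->
  \forall Y \near X, `|(charpolyC Y).[z]| < toC d.
Proof.
move=> d0 /rootP Xz; have d20 : 0 < d / 2 by rewrite divr_gt0.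
have [/(_ X)/cvgrPdist_lt/(_ _ d20) nearRe
      /(_ X)/cvgrPdist_lt/(_ _ d20) nearIm] :=
  @continuousC_horner_charpoly R n z.
rewrite /= Xz in nearRe nearIm.
near=> Y; rewrite [X in `|X|]complexE (le_lt_trans (ler_normD _ _)) //.
have -> : toC d = toC (d / 2) + toC (d / 2) by rewrite -rmorphD -splitr.
have normR (x : R) : `|x%:C%C| = toC `|x|.
  by rewrite normc_def /= expr0n addr0 sqrtr_sqr.
have normI : `|'i%C : R[i]| = 1.
  by rewrite normc_def /= expr0n expr1n add0r sqrtr1.
rewrite normrM normI mul1r !normR ltrD // ltcR -normrN -[X in `|X|]add0r.
  by near: Y.
by near: Y.
Unshelve. all: by end_near. Qed.

Lemma conjc_fixed (z : R[i]) : (complex.Im z == 0) = (conjc z == z).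
Proof.
by case: z => x y; rewrite eq_complex /= eqxx eqNr.
Qed.

Lemma open_simple_spectrum n s : open (@simple_spectrum R n s).
Proof.
rewrite openE => X [rs [urs Xrs crs]]; have srs := simple_spectrum_size Xrs.
have rsE z : (z \in rs) = root (charpolyC X) z by rewrite Xrs root_prod_XsubC.
have rsJ z : z \in rs -> conjc z \in rs by rewrite !rsE root_charpolyC_conj.
have [e e0 sep] := separation rs.
have close z z' w : z \in rs -> z' \in rs -> `|w - z| < toC e ->
    `|w - z'| < toC e -> z = z'.
  move=> zrs z'rs wz wz'; apply/eqP; apply: contraT => /(sep _ _ zrs z'rs).
  rewrite real_leNgt ?normr_real // -?rmorphD; last first.
    by apply/complex_realP; eexists.
  move/negP; case; rewrite (_ : z - z' = (w - z') - (w - z)); last by ring.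
  by rewrite (le_lt_trans (ler_normB _ _)) // rmorphD ltrD.
(* The bound [e ^+ n] is the one under which [near_root] places one of the [n] eigenvalues of [Y]
   within [e]. *)
have : \forall Y \near X, forall i : 'I_(size rs),
    `|(charpolyC Y).[rs`_i]| < toC (e ^+ n).
  apply: (@filter_forall _ _ (fun (i : 'I_(size rs)) (Y : 'M[R]_n) =>
    `|(charpolyC Y).[rs`_i]| < toC (e ^+ n)) _ (nbhs_filter X)) => i.
  apply: near_charpolyC_small; first exact: exprn_gt0.
  by rewrite -rsE mem_nth.
apply: filterS => Y small.
have [ws Yws] := closed_field_poly_normal (charpolyC Y).
rewrite (monicP (charpolyC_monic Y)) scale1r in Yws.
have sws := simple_spectrum_size Yws.
(* [f] sends each eigenvalue of [X] to a nearby one of [Y]; outside [rs] its value is irrelevant,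
   and 0 serves as witness. *)
have /choice[f fP] :
    forall z, exists w, z \in rs -> w \in ws /\ `|w - z| < toC e.
  move=> z; case: (boolP (z \in rs)) => [zrs|_]; last by exists 0.
  have [] := @near_root R ws z e e0; last by move=> w; exists w.
  rewrite -Yws sws -rmorphXn /=.
  have iz : (index z rs < size rs)%N by rewrite index_mem.
  by have := small (Ordinal iz); rewrite /= nth_index.
have fws z : z \in rs -> f z \in ws by case/fP.
have fz z : z \in rs -> `|f z - z| < toC e by case/fP.
have finj : {in rs &, injective f}.
  by move=> z z' zrs z'rs zz'; apply: (close _ _ (f z)) => //;
    [exact: fz | rewrite zz'; exact: fz].
have urs' : uniq [seq f z | z <- rs] by rewrite map_inj_in_uniq.
have rootf z : z \in rs -> root (charpolyC Y) (f z).
  by move=> zrs; rewrite Yws root_prod_XsubC fws.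
have Yrs : charpolyC Y = \prod_(z <- [seq f z | z <- rs]) ('X - z%:P).
  apply: charpolyC_distinct => //; first by rewrite size_map.
  by apply/allP => _ /mapP[z zrs ->]; apply: rootf.
exists [seq f z | z <- rs]; split => //.
rewrite count_map -crs; apply: eq_in_count => z zrs /=.
have distJ w x : `|conjc w - conjc x| = `|w - x| :> R[i].
  by rewrite -rmorphB normcJ.
rewrite !conjc_fixed; apply/eqP/eqP => [fzJ|zJ].
  (* A real [f z] is close to both [z] and its conjugate, which therefore coincide. *)
  apply: (close _ _ (f z)); rewrite ?rsJ ?fz //.
  by rewrite -fzJ distJ fz.
(* For real [z], the conjugate of [f z] is some [f z']; it is close to both [z] and [z'], so
   [z' = z]. *)
have : conjc (f z) \in [seq f z | z <- rs].
  by rewrite -root_prod_XsubC -Yrs root_charpolyC_conj rootf.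
case/mapP=> z' z'rs fzz'; rewrite fzz'; congr f.
apply: (close _ _ (f z')); rewrite ?fz //.
by rewrite -fzz' -{2}zJ distJ fz.
Qed.

End Openness.

(** * Density *)

Section Density.
Variable R : realType.
Local Notation toC := (real_complex R).

(** As [p] is nonzero, so is its gcd with the derivative; coprimality then means that this gcd has
    size at most 1. *)
Lemma separable_resultant (p : {poly R}) :
  p != 0 -> separable_poly p = (resultant p p^`() != 0).
Proof.
move=> p0; rewrite resultant_eq0 unlock /coprimep.
by rewrite -leqNgt leq_eqVlt ltnS leqn0 size_poly_eq0 gcdp_eq0 (negPf p0) orbF.
Qed.

Lemma separable_simple_spectrum n (X : 'M[R]_n) :
  separable_poly (char_poly X) ->
  exists t : 'I_(n./2).+1, simple_spectrum (n - t.*2) X.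
Proof.
rewrite -(separable_map toC) -/(charpolyC X) => sepX.
have [rs Xrs] := closed_field_poly_normal (charpolyC X).
rewrite (monicP (charpolyC_monic X)) scale1r in Xrs.
have urs : uniq rs by rewrite -separable_prod_XsubC -Xrs.
have rsE z : (z \in rs) = root (charpolyC X) z by rewrite Xrs root_prod_XsubC.
have rsJ z : z \in rs -> conjc z \in rs by rewrite !rsE root_charpolyC_conj.
have := size_conj_closed urs rsJ; rewrite (simple_spectrum_size Xrs).
(* [t] counts the eigenvalues in the upper half-plane. *)
set t := count _ _ => nE.
have t_lt : (t < (n./2).+1)%N by rewrite ltnS geq_half_double nE leq_addr.
exists (Ordinal t_lt); exists rs; split => //=.
by rewrite nE addKn.
Qed.

(* [X + V] is the diagonal matrix (0, ..., n), and [p.[s]] the discriminant of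
   the characteristic polynomial of [X + s *: V]. *)
Lemma separable_line n (X : 'M[R]_n.+1) :
  exists (V : 'M[R]_n.+1) (p : {poly R}),
  p != 0 /\ forall s, p.[s] != 0 -> separable_poly (char_poly (X + s *: V)).
Proof.
pose N : 'M[R]_n.+1 := diag_mx (\row_(i < n.+1) i%:R).
pose P := map_mx polyC X + 'X *: map_mx polyC (N - X).
exists (N - X), (resultant (char_poly P) (char_poly P)^`()).
have evP s :
    map_poly (horner_eval s) (char_poly P) = char_poly (X + s *: (N - X)).
  rewrite map_char_poly; congr char_poly; apply/matrixP => i j.
  by rewrite !mxE /= !(horner_evalE, hornerE).
have lead1 : lead_coef (char_poly P) = 1 by apply/monicP/char_poly_monic.
(* In characteristic 0 this constant is nonzero, so no value of the parameter lowers the degree and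
   the resultant commutes with evaluation. *)
have lead' : lead_coef (char_poly P)^`() = n.+1%:R.
  have coefn : (char_poly P)^`()`_n = n.+1%:R.
    have leadE : (char_poly P)`_n.+1 = 1.
      by rewrite -lead1 lead_coefE size_char_poly.
    by rewrite coef_deriv leadE.
  suff sz : size (char_poly P)^`() = n.+1 by rewrite lead_coefE sz.
  apply/eqP; rewrite eqn_leq; apply/andP; split.
    rewrite -ltnS -(size_char_poly P) lt_size_deriv //.
    by rewrite monic_neq0 ?char_poly_monic.
  rewrite ltnNge; apply/negP => /leq_sizeP/(_ n (leqnn n)) /eqP.
  by rewrite coefn -polyC_natr polyC_eq0 pnatr_eq0.
have evRes s : (resultant (char_poly P) (char_poly P)^`()).[s] =
    resultant (char_poly (X + s *: (N - X))) (char_poly (X + s *: (N - X)))^`().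
  rewrite -horner_evalE map_resultant.
  - by rewrite -deriv_map evP.
  - by rewrite lead1 rmorph1 oner_eq0.
  - by rewrite lead' rmorph_nat pnatr_eq0.
split=> [|s]; last first.
  by rewrite evRes separable_resultant ?monic_neq0 ?char_poly_monic.
(* The line reaches [N] at [s = 1], where the eigenvalues are distinct, so the discriminant is not
   the zero polynomial. *)
apply: contraTneq (_ : separable_poly (char_poly N)) => [res0|].
  rewrite separable_resultant ?monic_neq0 ?char_poly_monic //.
  rewrite -[N](subrK X) addrC -[N - X]scale1r -evRes res0.
  by rewrite horner0 eqxx.
rewrite char_poly_trig ?diag_mx_is_trig //.
rewrite (eq_bigr (fun i : 'I_n.+1 => 'X - (i%:R : R)%:P)); last first.
  by move=> i _; rewrite !mxE eqxx mulr1n.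
rewrite -(big_map (fun i : 'I_n.+1 => i%:R : R) predT (fun x => 'X - x%:P)).
rewrite separable_prod_XsubC map_inj_uniq ?index_enum_uniq // => i j /eqP.
by rewrite eqr_nat => /eqP/val_inj.
Qed.

(** A small parameter that is not a root of the discriminant gives a point of the line inside
    [U]. *)
Lemma simple_spectrum_dense n (X : 'M[R]_n.+1) (U : set 'M[R]_n.+1) :
  nbhs X U ->
  exists t : 'I_(n.+1./2).+1, simple_spectrum (n.+1 - t.*2) `&` U !=set0.
Proof.
move=> UX; have [V [p [p0 sepV]]] := separable_line X.
have : (fun s : R => X + s *: V) @ 0 --> X + 0 *: V.
  by apply: cvgD; [exact: cvg_cst|exact: scalel_continuous].
rewrite scale0r addr0 => lineX.
have /nbhs_norm0P[e /= e0 eU] : \forall s \near (0 : R), U (X + s *: V).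
  exact: lineX.
have [s [s0 se ps]] := small_nonroot p0 e0.
have [t tY] := separable_simple_spectrum (sepV s ps).
exists t, (X + s *: V); split => //.
by apply: eU; rewrite /= ger0_norm // ltW.
Qed.

End Density.

Theorem theorem3p2 (R : realType) (n : nat) (n_ge1 : (1 <= n)%N)
    (a b : forall t : 'I_(n./2).+1, 'I_t -> R)
    (c : forall t : 'I_(n./2).+1, 'I_(n - t.*2) -> R)
    (abc_adm : forall t : 'I_(n./2).+1, admissible (a t) (b t) (c t)) :
  let A (t : 'I_(n./2).+1) : 'M[R]_n := generic_mx (a t) (b t) (c t) in
  let B (t : 'I_(n./2).+1) : set 'M[R]_n := bundle (A t) in
  (forall (t : 'I_(n./2).+1) (a' b' : 'I_t -> R) (c' : 'I_(n - t.*2) -> R),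
     admissible a' b' c' -> bundle (generic_mx a' b' c') = B t) /\
  [set: 'M[R]_n] = \bigcup_(t in [set: 'I_(n./2).+1]) closure (B t) /\
  (forall t : 'I_(n./2).+1, codim_bundle (A t) = 0) /\
  (forall t t' : 'I_(n./2).+1, t != t' -> B t `&` closure (B t') = set0) /\
  (forall t : 'I_(n./2).+1, open (B t)).
Proof.
move=> A B; have BE t : B t = simple_spectrum (n - t.*2).
  exact: (bundle_generic n_ge1 (abc_adm t)).
have BA t : B t (A t).
  rewrite BE; exists (spectrum_of (a t) (b t) (c t)); split.
  - exact: uniq_spectrum_of.
  - apply: charpolyC_distinct; first exact: uniq_spectrum_of.
      by rewrite size_spectrum_of generic_dim.
    by apply/allP => z; rewrite root_generic_mx.
  - exact: count_spectrum_of.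
have openB t : open (B t) by rewrite BE; apply: open_simple_spectrum.
split=> [t a' b' c' adm|]; first by rewrite BE bundle_generic.
split; last split; last split => //.
- apply/esym/seteqP; split=> // X _; apply: contrapT => XB.
  (* If [X] lies in no closure, each bundle misses a neighbourhood of [X]; being finitely many, they
     all miss a common one, against density. *)
  have far t : \forall Y \near X, ~ B t Y.
    apply: contrapT => nXt; apply: XB; exists t => // U UX.
    apply: contrapT => /set0P/negP/negPn/eqP BU; apply: nXt.
    apply: filterS UX => Y UY BY.
    by have : (B t `&` U) Y by []; rewrite BU.
  case: n n_ge1 a b c abc_adm A B BE BA openB X XB far => //.
  move=> m _ ? ? ? _ A B BE _ _ X XB far.
  have [t [Y [tY]]] := simple_spectrum_dense
    (filter_forall (f := fun t => ~` B t) (nbhs_filter X) far).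
  by move/(_ t); apply; rewrite BE.
- by move=> t; have := BA t; rewrite BE; apply: codim_bundle_simple.
- move=> t t' tt'; apply/seteqP; split=> // X [BX clX].
  (* [B t] is a neighbourhood of [X], hence meets [B t']. *)
  have [Y [Y' Y'']] := clX _ (open_nbhs_nbhs (conj (openB t) BX)).
  rewrite !BE in Y' Y''; have := simple_spectrum_disjoint Y' Y''.
  (* As [2t <= n], subtracting the number of real eigenvalues from [n] recovers [2t]. *)
  move/(congr1 (fun k => n - k)%N); rewrite !subKn; last 2 first.
  - by rewrite -geq_half_double -ltnS.
  - by rewrite -geq_half_double -ltnS.
  by move/double_inj/val_inj => t't; rewrite t't eqxx in tt'.
Qed.
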